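(* Let $n\geq 2$ and $d$ be integers and set $h=\binom{n+\lfloor d/2\rfloor}{n}$. Suppose that one of the following holds: (i) $d=3$ and $2\leq n\leq 30$; (ii) $d=5$ and $3\leq n\leq 8$; (iii) $d=7$ and $n=4$. Then Comon's conjecture holds for the general degree $d$ homogeneous polynomial in $n+1$ variables of rank $h$. That is, there exists a non-empty Zariski open subset $\mathcal{U}\subseteq \mathrm{Sec}_h(\mathcal{V}_d^n)$ such that every $F\in\mathcal{U}$ satisfies $\mathrm{rank}_{\mathcal{V}_d^n}(F)=\mathrm{rank}_{\mathcal{S}}(F)$, where $\mathcal{S}\cong(\mathbb{P}^n)^d$ is the Segre variety into which $\mathcal{V}_d^n$ is diagonally embedded.
   Context: The base field $k$ is algebraically closed of characteristic zero. Let $V$ be a $k$-vector space of dimension $n+1$. The Segre variety $\mathcal{S}\subset\mathbb{P}(V^{\otimes d})$ is the set of classes $[v_1\otimes\dots\otimes v_d]$ with $v_i\in V\setminus\{0\}$. The Veronese variety $\mathcal{V}_d^n\subset\mathbb{P}(\mathrm{Sym}^dV)$ is the set of classes $[v^{\otimes d}]$ with $v\in V\setminus\{0\}$; here $\mathrm{Sym}^dV\subset V^{\otimes d}$ is the subspace of symmetric tensors, identified with the space $k[x_0,\dots,x_n]_d$ of homogeneous polynomials of degree $d$ (so $v^{\otimes d}$ corresponds to the $d$-th power of a linear form). Thus $\mathcal{V}_d^n\subset\mathcal{S}$. For a projective variety $X\subset\mathbb{P}^N$ and a point $p$ in the linear span of $X$, $\mathrm{rank}_X(p)$ is the minimal integer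 $r$ such that $p$ lies in the linear span of $r$ distinct points of $X$. The $h$-secant variety $\mathrm{Sec}_h(X)$ is the Zariski closure of the union of all $(h-1)$-planes spanned by $h$ general points of $X$. *)

(* Defs.v *)
From HB Require Import structures.
From mathcomp Require Import all_boot all_fingroup all_algebra.
From mathcomp Require Import mpoly.

Set Implicit Arguments.
Unset Strict Implicit.
Unset Printing Implicit Defensive.

Import GRing.Theory.
Local Open Scope ring_scope.

Section ProjectiveSpace.
Variables (k : fieldType) (W : vectType k).

(* Points of P(W) are the one-dimensional subspaces of W; equality of points
   is equality of subspaces. *)
Record proj := Proj { line :> {vspace W}; _ : \dim line == 1%N }.

HB.instance Definition _ := [isSub for line].
HB.instance Definition _ := [Choice of proj by <:].

Lemma line_dim (x : proj) : \dim x = 1%N.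
Proof. by apply/eqP; case: x. Qed.

Definition pspan (r : nat) (x : 'I_r -> proj) : {vspace W} :=
  (\sum_(i < r) line (x i))%VS.

(* Polynomial functions on W are written in the coordinates of a fixed basis;
   neither homogeneity nor the resulting topology depends on that basis. *)
Definition peval (p : {mpoly k[\dim {:W}]}) (w : W) : k :=
  p.@[fun i => coord (vbasis {:W}) i w].

Definition zero_at (p : {mpoly k[\dim {:W}]}) (x : proj) : Prop :=
  forall w : W, w \in line x -> peval p w = 0.

Definition zclosed (Z : proj -> Prop) : Prop :=
  exists S : {mpoly k[\dim {:W}]} -> Prop,
    (forall p, S p -> exists e : nat, p \is e.-homog) /\
    (forall x, Z x <-> forall p, S p -> zero_at p x).

Definition zclosure (A : proj -> Prop) (x : proj) : Prop :=
  forall Z, zclosed Z -> (forall y, A y -> Z y) -> Z x.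

(* Open for the topology induced on Y by the Zariski topology of P(W). *)
Definition zopen_in (Y U : proj -> Prop) : Prop :=
  exists2 Z, zclosed Z & forall x, U x <-> (Y x /\ ~ Z x).

Definition in_span_of (X : proj -> Prop) (r : nat) (p : proj) : Prop :=
  exists x : 'I_r -> proj,
    [/\ injective x, forall i, X (x i) & (line p <= pspan x)%VS].

Definition has_rank (X : proj -> Prop) (p : proj) (r : nat) : Prop :=
  in_span_of X r p /\ forall s, in_span_of X s p -> (r <= s)%N.

(* "h general points": the points are asked to span an (h-1)-plane of P(W),
   i.e. a linear subspace of W of dimension h.  For irreducible X whose span
   has dimension at least h, discarding a proper closed set of h-tuples does
   not change the closure. *)
Definition on_secant_plane (X : proj -> Prop) (h : nat) (p : proj) : Prop :=
  exists x : 'I_h -> proj,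
    [/\ forall i, X (x i), \dim (pspan x) = h & (line p <= pspan x)%VS].

Definition secant (X : proj -> Prop) (h : nat) : proj -> Prop :=
  zclosure (on_secant_plane X h).

End ProjectiveSpace.

Section Tensors.
Variables (k : fieldType) (n d : nat).

(* With V = k^(n+1), the tensor T in V^{(x) d} is the family of its
   coordinates T i on the basis e_(i 0) (x) ... (x) e_(i (d-1)). *)
Definition tensor : vectType k := {ffun {ffun 'I_d -> 'I_n.+1} -> k^o}.

Definition pure_tensor (v : 'I_d -> 'rV[k]_n.+1) : tensor :=
  [ffun i : {ffun 'I_d -> 'I_n.+1} => \prod_(j < d) v j 0 (i j)].

Definition power_tensor (v : 'rV[k]_n.+1) : tensor := pure_tensor (fun=> v).

Definition segre (x : proj tensor) : Prop :=
  exists v : 'I_d -> 'rV[k]_n.+1,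
    (forall j, v j != 0) /\ line x = <[pure_tensor v]>%VS.

(* The Veronese variety is viewed inside P(V^{(x) d}), through the inclusion
   of P(Sym^d V): see veronese_symmetric and secant_veronese_symmetric. *)
Definition veronese (x : proj tensor) : Prop :=
  exists v : 'rV[k]_n.+1, v != 0 /\ line x = <[power_tensor v]>%VS.

Definition symmetric_tensor (T : tensor) : Prop :=
  forall (s : 'S_d) (i : {ffun 'I_d -> 'I_n.+1}), T [ffun j => i (s j)] = T i.

Definition form_of_tensor (T : tensor) : {mpoly k[n.+1]} :=
  \sum_(i : {ffun 'I_d -> 'I_n.+1}) T i *: \prod_(j < d) 'X_(i j).

Lemma form_of_power_tensor (v : 'rV[k]_n.+1) :
  form_of_tensor (power_tensor v) = (\sum_(i < n.+1) v 0 i *: 'X_i) ^+ d.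
Proof.
rewrite -[d in RHS]card_ord -prodr_const bigA_distr_bigA /=.
by apply: eq_bigr => i _; rewrite ffunE scaler_prod.
Qed.

Lemma veronese_segre (x : proj tensor) : veronese x -> segre x.
Proof. by case=> v [v0 xv]; exists (fun=> v). Qed.

Lemma pure_tensor_neq0 (v : 'I_d -> 'rV[k]_n.+1) :
  (forall j, v j != 0) -> pure_tensor v != 0.
Proof.
move=> v0; have nz j : {i | v j 0 i != 0}.
  by apply/sigW/rV0Pn.
apply/eqP => /ffunP/(_ [ffun j => sval (nz j)]); rewrite !ffunE => /eqP.
apply/negP/prodf_neq0 => j _; rewrite ffunE; exact: (svalP (nz j)).
Qed.

Lemma symmetric_tensorZ (a : k) (T : tensor) :
  symmetric_tensor T -> symmetric_tensor (a *: T).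
Proof. by move=> sT s i; rewrite !ffunE sT. Qed.

Lemma symmetric_power_tensor (v : 'rV[k]_n.+1) :
  symmetric_tensor (power_tensor v).
Proof.
move=> s i; rewrite !ffunE [RHS](reindex_inj (@perm_inj _ s)) /=.
by apply: eq_bigr => j _; rewrite ffunE.
Qed.

Lemma veronese_symmetric (x : proj tensor) (T : tensor) :
  veronese x -> T \in line x -> symmetric_tensor T.
Proof.
case=> v [_ ->] /vlineP[a ->].
exact/symmetric_tensorZ/symmetric_power_tensor.
Qed.

Lemma zclosed_symmetric :
  zclosed (fun x : proj tensor =>
    forall T : tensor, T \in line x -> symmetric_tensor T).
Proof.
pose e l : tensor := (vbasis {:tensor})`_l.
pose sw (s : 'S_d) (i : {ffun 'I_d -> 'I_n.+1}) := [ffun j => i (s j)].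
pose lf s i : {mpoly k[\dim {:tensor}]} :=
  \sum_(l < \dim {:tensor}) (e l (sw s i) - e l i) *: 'X_l.
have lfE s i T : peval (lf s i) T = T (sw s i) - T i.
  have Te j : T j = \sum_l coord (vbasis {:tensor}) l T * e l j.
    rewrite {1}(coord_vbasis (memvf T)) sum_ffunE.
    by apply: eq_bigr => l _; rewrite ffunE.
  rewrite !Te -sumrB /peval /lf raddf_sum /=; apply: eq_bigr => l _.
  by rewrite mevalZ mevalXU -mulrBr mulrC.
exists (fun p => exists s i, p = lf s i); split.
  move=> p [s [i ->]]; exists 1%N; apply: rpred_sum => l _.
  by apply: rpredZ; rewrite dhomogX; apply/eqP/mdeg1.
move=> x; split=> [sx p [s [i ->]] T Tx | zx T Tx s i].
  by rewrite lfE sx // subrr.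
by apply/eqP; rewrite -subr_eq0 -lfE; apply/eqP/(zx _ _ T Tx); exists s, i.
Qed.

Lemma secant_veronese_symmetric (h : nat) (x : proj tensor) (T : tensor) :
  secant veronese h x -> T \in line x -> symmetric_tensor T.
Proof.
move=> /(_ _ zclosed_symmetric) + Tx; apply=> // y [z [Vz _ /subvP yz]] U.
move=> /yz /memv_sumP[u uz ->] s i; rewrite !sum_ffunE.
by apply: eq_bigr => j _; apply: veronese_symmetric (Vz j) (uz j isT) s i.
Qed.

End Tensors.

Arguments segre {k n d} x.
Arguments veronese {k n d} x.

(* Main.v *)
(* Let d = 2m+1, so that h is the number of monomials of degree m.  Slicing a
   symmetric tensor T along its first factor gives n+1 symmetric h x h matrices
   A_0, ..., A_n.  If A_0 is invertible then T is not a sum of fewer than h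
   pure tensors, because the rank of A_0 is subadditive.  On sums of h powers
   the matrices A_0^-1 A_l commute; this is a polynomial condition, so it
   persists on the secant variety.  If moreover A_0^-1 A_1 has h distinct
   eigenvalues (below A_n plays the role of A_1), then the A_l are diagonalized
   by a common congruence, and the symmetry of T forces the h diagonal terms to
   be d-th powers.  Both conditions are open.  They hold together for a sum of
   powers of h points with Kronecker-type coordinates 2 ^ (s (B ^ i - 1)),
   where the evaluation matrix of the monomials of degree m is a Vandermonde
   matrix. *)
Require Import Defs.
From mathcomp Require Import all_boot all_fingroup all_algebra.
From mathcomp Require Import mpoly separable ring.

Set Implicit Arguments.
Unset Strict Implicit.
Unset Printing Implicit Defensive.

Import GRing.Theory.
Local Open Scope ring_scope.

(** * Points of a projective space and their spans *)

Section Spans.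
Variables (k : fieldType) (W : vectType k).

Definition proj_of (w : W) (w0 : w != 0) : proj W :=
  Proj (introT eqP (etrans (dim_vline w) (congr1 nat_of_bool w0))).

Lemma proj_lineE (x : proj W) (w : W) :
  w \in line x -> w != 0 -> line x = <[w]>%VS.
Proof.
move=> xw w0; apply/esym/eqP; rewrite eqEdim -memvE xw dim_vline w0.
by rewrite line_dim.
Qed.

Lemma memv_pspanP r (y : 'I_r -> proj W) (u : 'I_r -> W) w :
  (forall q, line (y q) = <[u q]>%VS) ->
  w \in pspan y <-> exists c : 'I_r -> k, w = \sum_q c q *: u q.
Proof.
move=> yu; split=> [/memv_sumP[z yz ->] | [c ->]]; last first.
  by apply: memv_sumr => q _; rewrite yu memvZ ?memv_line.
have /fin_all_exists[c cE] q : exists c, z q = c *: u q.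
  by apply/vlineP; rewrite -yu yz.
by exists c; apply: eq_bigr => q _.
Qed.

End Spans.

(** * Zariski closed sets given by arbitrary polynomials *)

Section ZariskiClosedSets.
Variables (k : closedFieldType) (W : vectType k).
Implicit Type p : {mpoly k[\dim {:W}]}.

Lemma peval_homogZ p e (c : k) (w : W) :
  p \is e.-homog -> peval p (c *: w) = c ^+ e * peval p w.
Proof.
move=> /dhomogP hp; rewrite /peval !mevalE mulr_sumr; apply: eq_big_seq => u pu.
rewrite mulrCA; congr (_ * _); rewrite -(hp u pu) /= mdegE -prodrXr -big_split /=.
by apply: eq_bigr => i _; rewrite linearZ exprMn.
Qed.

(** Scaling w by c multiplies the degree i component of p by c^i, so the values of the components at
    w are the coefficients of p along the line of w. *)
Lemma peval_line_poly p (w : W) e : exists2 q : {poly k},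
  forall c, q.[c] = peval p (c *: w) & q`_e = peval (pihomog mdeg e p) w.
Proof.
pose N := maxn (msize p) e.+1.
exists (\poly_(i < N) peval (pihomog mdeg i p) w) => [c|]; last first.
  by rewrite coef_poly leq_maxr.
rewrite horner_poly [p in RHS](@pihomog_partitionE _ _ mdeg N p) ?leq_maxl //.
rewrite /peval raddf_sum /=; apply: eq_bigr => i _.
by rewrite mulrC; apply/esym/peval_homogZ/pihomogP.
Qed.

Lemma peval_pihomog_eq0 p (w : W) :
  (forall c : k, peval p (c *: w) = 0) ->
  forall e, peval (pihomog mdeg e p) w = 0.
Proof.
move=> p0 e; have [q qE <-] := peval_line_poly p w e.
suff -> : q = 0 by rewrite coef0.
apply/eqP; apply: contraT => /closed_nonrootP[c] /negP[].
by rewrite /root qE p0.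
Qed.

(** The witness needs no classical logic: along the line, p is a polynomial in one variable, which
    is either zero or has a non-root. *)
Lemma zero_atPn p (x : proj W) :
  ~ zero_at p x -> exists2 w, w \in line x & peval p w != 0.
Proof.
move=> nx; pose w := vpick (line x).
have w0 : w != 0 by rewrite vpick0 -dimv_eq0 line_dim.
have [q qE _] := peval_line_poly p w 0.
have [q0 | /closed_nonrootP[c]] := eqVneq q 0; last first.
  by rewrite /root qE; exists (c *: w); rewrite // memvZ ?memv_pick.
case: nx => u; rewrite (proj_lineE (memv_pick _) w0) => /vlineP[c ->].
by rewrite -qE q0 horner0.
Qed.

(** A line is stable under scaling and k is infinite, so p vanishes on the line exactly when all its
    homogeneous components do; these replace p among the equations. *)
Lemma zclosed_zeros (S : {mpoly k[\dim {:W}]} -> Prop) :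
  zclosed (fun x : proj W => forall p, S p -> zero_at p x).
Proof.
exists (fun q => exists p e, S p /\ q = pihomog mdeg e p); split.
  by move=> _ [p [e [_ ->]]]; exists e; apply: pihomogP.
move=> x; split=> [x0 _ [p [e [Sp ->]]] w xw | x0 p Sp w xw].
  by apply: peval_pihomog_eq0 => c; apply: x0 Sp _ _; apply: memvZ.
rewrite /peval [p](@pihomog_partitionE _ _ mdeg (msize p)) // raddf_sum /=.
by apply: big1 => i _; apply: x0 xw; exists p, i.
Qed.

Lemma zclosed_zero_at p : zclosed (zero_at p).
Proof.
have [S [homS ZS]] := zclosed_zeros (eq p).
by exists S; split=> // x; rewrite -ZS; split=> [x0 _ <- | /(_ p erefl)].
Qed.

End ZariskiClosedSets.

(** * Simple spectra and simultaneous diagonalization *)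

Section SeparableMatrices.
Variables (k : closedFieldType) (h : nat).
Implicit Types (P X Y : 'M[k]_h.+1) (d : 'rV[k]_h.+1).

Lemma char_poly_conj_diag P Y d : P \in unitmx -> P *m Y = diag_mx d *m P ->
  char_poly Y = \prod_(x <- [seq d 0 i | i : 'I_h.+1]) ('X - x%:P).
Proof.
move=> uP PY.
have : map_mx polyC P *m char_poly_mx Y
       = char_poly_mx (diag_mx d) *m map_mx polyC P.
  by rewrite /char_poly_mx mulmxBr mulmxBl -!map_mxM PY scalar_mxC.
move/(congr1 determinant); rewrite !det_mulmx mulrC det_map_mx.
have P0 : (\det P)%:P != 0 by rewrite polyC_eq0 -unitfE -unitmxE.
move=> /(mulIf P0); rewrite -/(char_poly _) => ->; rewrite -/(char_poly _).
rewrite char_poly_trig ?diag_mx_is_trig // big_image.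
by apply: eq_bigr => i _; rewrite mxE eqxx.
Qed.

(** With f the characteristic polynomial of Y, the matrix f'(Y) is singular exactly when f and f'
    share a root. Simplicity of the spectrum thus becomes the nonvanishing of a polynomial in the
    entries of Y. *)
Lemma unitmx_deriv_char_polyP Y :
  reflect (exists P d, [/\ P \in unitmx, injective (d 0)
                         & P *m Y = diag_mx d *m P])
          (horner_mx Y (char_poly Y)^`() \in unitmx).
Proof.
apply: (iffP idP) => [uY | [P [d [uP dI PY]]]]; last first.
  have : separable_poly (char_poly Y).
    by rewrite (char_poly_conj_diag uP PY) separable_prod_XsubC map_inj_uniq ?enum_uniq.
  (* Evaluated at Y, the Bezout identity of f and f' loses its f term by Cayley-Hamilton and
     exhibits an inverse of f'(Y). *)
  rewrite separable_poly.unlock => /Bezout_eq1_coprimepP[u] /(congr1 (horner_mx Y)).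
  rewrite rmorphD !rmorphM /= Cayley_Hamilton mulr0 add0r rmorph1.
  by move/mulmx1_unit => [].
have sepY : separable_poly (char_poly Y).
  (* For a common root of f and f', the invertible f'(Y) would kill an eigenvector of Y. *)
  rewrite separable_poly.unlock; apply: Pdiv.ClosedField.root_coprimep => a.
  rewrite -eigenvalue_root_char => /eigenvalueP[v vY v0].
  apply: contra_neq v0 => /eqP/factor_theorem[r fr].
  rewrite -[v](mulmxK uY) fr mulrC rmorphM rmorphB /= horner_mx_X horner_mx_C.
  by rewrite -mulmxE mulmxA mulmxBr vY mul_mx_scalar subrr !mul0mx.
have [rs fE] := closed_field_poly_normal (char_poly Y).
rewrite (monicP (char_poly_monic Y)) scale1r in fE.
have /diagonalizableP[P uP /(similar_diagLR uP)[d Yd]] :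
    exists2 rs, uniq rs & mxminpoly Y %| \prod_(x <- rs) ('X - x%:P).
  exists rs; first by rewrite -separable_prod_XsubC -fE.
  by rewrite -fE mxminpoly_dvd_char.
have PY : P *m Y = diag_mx d *m P by rewrite Yd conjVmx // -mulmxA mulKVmx.
exists P, d; split=> //; apply/injectiveP.
by rewrite /injectiveb /dinjectiveb -separable_prod_XsubC -(char_poly_conj_diag uP PY).
Qed.

Lemma comm_diag_mx X d : injective (d 0) ->
  X *m diag_mx d = diag_mx d *m X -> X = diag_mx (\row_i X i i).
Proof.
move=> dI /matrixP XdC; apply/matrixP=> i j; rewrite !mxE.
case: eqVneq => [<- | ij]; first by rewrite mulr1n.
rewrite mulr0n; apply/eqP; have := XdC i j.
rewrite mul_mx_diag mul_diag_mx !mxE mulrC => /eqP.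
rewrite -subr_eq0 -mulrBl mulf_eq0 subr_eq0 => /orP[/eqP/dI ji|//].
by rewrite ji eqxx in ij.
Qed.

Lemma adjmx_unit (R : comUnitRingType) r (A : 'M[R]_r) :
  A \in unitmx -> \adj A = \det A *: invmx A.
Proof. by move=> uA; rewrite /invmx uA scalerA divrr ?scale1r // -unitmxE. Qed.

(** Since Y has distinct eigenvalues, whatever commutes with it is diagonal in its eigenbasis; by
    hypothesis this covers every A_0^-1 A_l. The Gram matrix [B] of A_0 in that basis is diagonal
    too, because Y is self-adjoint for A_0. The adjugate keeps Y polynomial in the entries. *)
Lemma symmetric_pencil_diagonalization (L : Type) (A : L -> 'M[k]_h.+1) l0 l1 :
  let Y := \adj (A l0) *m A l1 in
  A l0 \in unitmx -> horner_mx Y (char_poly Y)^`() \in unitmx ->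
  (forall l, (A l)^T = A l) ->
  (forall l, A l1 *m invmx (A l0) *m A l = A l *m invmx (A l0) *m A l1) ->
  exists P (b : 'rV[k]_h.+1) (c : L -> 'rV[k]_h.+1),
    [/\ P \in unitmx, forall s, b 0 s != 0, forall s, c l0 0 s = 1,
        injective (c l1 0)
      & forall l, A l = P^T *m diag_mx b *m diag_mx (c l) *m P].
Proof.
move=> Y uA /unitmx_deriv_char_polyP[P [d [uP dI PY]]] symA commA.
have uPT : P^T \in unitmx by rewrite unitmx_tr.
have YE : Y = \det (A l0) *: (invmx (A l0) *m A l1).
  by rewrite /Y adjmx_unit // scalemxAl.
clearbody Y.
have det0 : \det (A l0) != 0 by rewrite -unitfE -unitmxE.
pose X l := P *m (invmx (A l0) *m A l) *m invmx P.
have dE : diag_mx d = P *m Y *m invmx P by rewrite PY mulmxK.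
pose c l : 'rV[k]_h.+1 := \row_i X l i i.
have XE l : X l = diag_mx (c l).
  apply: (comm_diag_mx dI); rewrite dE YE /X !mulmxA !mulmxKV //.
  rewrite -!scalemxAr -!scalemxAl -!mulmxA; congr (_ *: (_ *m _)).
  by rewrite !mulmxA -!(mulmxA (invmx (A l0))) commA.
have AY : A l0 *m Y = Y^T *m A l0.
  rewrite YE !linearZ /= trmx_mul trmx_inv !symA -scalemxAl.
  by rewrite mulKVmx // mulmxKV.
pose B := invmx P^T *m A l0 *m invmx P.
have BE : B = diag_mx (\row_i B i i).
  apply: (comm_diag_mx dI); rewrite -{2}[diag_mx d]tr_diag_mx dE.
  rewrite !trmx_mul trmx_inv /B !mulmxA mulmxKV // mulmxK //.
  by rewrite -[in LHS](mulmxA _ (A l0)) AY mulmxA.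
exists P, (\row_i B i i), c; split=> //.
- have : B \in unitmx by rewrite !unitmx_mul !unitmx_inv uPT uA.
  rewrite {1}BE unitmxE det_diag unitfE => /prodf_neq0 nz s.
  exact: nz.
- by move=> s; rewrite /c mxE /X mulVmx // mulmx1 mulmxV // mxE eqxx.
(* Because of the adjugate, [d] is [c l1] times the determinant of A_0. *)
- move=> s t cst; apply: dI.
  have dcE : diag_mx d = \det (A l0) *: diag_mx (c l1).
    by rewrite dE YE -scalemxAr -scalemxAl -/(X l1) XE.
  have dcs u : d 0 u = \det (A l0) * c l1 0 u.
    by have /matrixP/(_ u u) := dcE; rewrite [LHS]mxE [RHS]mxE [in RHS]mxE eqxx.
  by rewrite !dcs cst.
- move=> l; rewrite -BE -XE /B /X !mulmxA mulmxV // mul1mx !mulmxKV //.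
  by rewrite mulmxV // mul1mx.
Qed.

End SeparableMatrices.

(** * Monomials as sorted words *)

Section Monomials.
Variables n m : nat.

(* The monomials of degree m are the sorted words of length m; the predecessor
   makes the number of monomials a syntactic successor. *)
Definition nmono := 'C(n + m, n).-1.

Definition sorted_words :=
  enum [set t : m.-tuple 'I_n.+1 | sorted leq [seq val i | i <- t]].

Definition mono (a : 'I_nmono.+1) : seq 'I_n.+1 :=
  nth [tuple of nseq m ord0] sorted_words a.

Lemma nmonoE : nmono.+1 = 'C(n + m, n).
Proof. by rewrite prednK // bin_gt0 leq_addr. Qed.

Lemma size_sorted_words : size sorted_words = nmono.+1.
Proof.
by rewrite -cardE card_sorted_tuples nmonoE addnC -bin_sub ?leq_addl ?addnK.
Qed.

Lemma size_mono a : size (mono a) = m.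
Proof. exact: size_tuple. Qed.

Lemma sorted_mono a : sorted leq [seq val i | i <- mono a].
Proof.
have : nth [tuple of nseq m ord0] sorted_words a \in sorted_words.
  by rewrite mem_nth // size_sorted_words.
by rewrite mem_enum inE.
Qed.

Lemma perm_mono_inj a b : perm_eq (mono a) (mono b) -> a = b.
Proof.
move=> /(perm_map val) pab; apply/ord_inj/eqP.
rewrite -(@nth_uniq _ [tuple of nseq m ord0] sorted_words);
  rewrite ?size_sorted_words ?enum_uniq //.
apply/eqP/val_inj/(inj_map val_inj).
exact: (sorted_eq leq_trans anti_leq (sorted_mono a) (sorted_mono b) pab).
Qed.

Lemma perm_monoP (s : seq 'I_n.+1) :
  size s = m -> exists a, perm_eq s (mono a).
Proof.
move=> sm; pose r (i j : 'I_n.+1) := (i <= j)%N.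
have sz : size (sort r s) == m by rewrite size_sort sm.
have : Tuple sz \in sorted_words.
  rewrite mem_enum inE /= sorted_map; apply: sort_sorted => i j.
  exact: leq_total.
case/(nthP [tuple of nseq m ord0]) => a; rewrite size_sorted_words => ha aE.
by exists (Ordinal ha); rewrite /mono /= aE /= perm_sym perm_sort.
Qed.

(** The default [ord0] is returned only for words whose length is not m. *)
Definition mono_idx (s : seq 'I_n.+1) : 'I_nmono.+1 :=
  odflt ord0 [pick a | perm_eq s (mono a)].

Lemma perm_mono_idx s : size s = m -> perm_eq s (mono (mono_idx s)).
Proof.
by rewrite /mono_idx => /perm_monoP[a sa]; case: pickP => [//|/(_ a)]; rewrite sa.
Qed.

Lemma mono_idx_perm s t : perm_eq s t -> mono_idx s = mono_idx t.
Proof.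
by move=> /permPl st; rewrite /mono_idx; congr odflt; apply: eq_pick => a /=.
Qed.

Lemma mono_idxK a : mono_idx (mono a) = a.
Proof. by apply/esym/perm_mono_inj/perm_mono_idx/size_mono. Qed.

End Monomials.

(** * Coordinates of tensors indexed by words *)

Section WordCoordinates.
Variables (k : fieldType) (n d : nat).
Implicit Types (T : tensor k n d) (s t : seq 'I_n.+1).

(** Words of unconstrained length spare casts in concatenations; on words of length d the default
    letter is never read. *)
Definition word_index s : {ffun 'I_d -> 'I_n.+1} := [ffun j : 'I_d => nth ord0 s j].

Definition word_coord T s : k := T (word_index s).

Lemma word_coord_perm T s t : symmetric_tensor T -> size t = d ->
  perm_eq s t -> word_coord T s = word_coord T t.
Proof.
move=> symT /eqP td; rewrite -[t]/(val (Tuple td)) => /tuple_permP[p ->].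
rewrite /word_coord -(symT p (word_index (Tuple td))); congr (T _).
by apply/ffunP=> j; rewrite !ffunE -[LHS](tnth_nth _ _ j) tnth_mktuple (tnth_nth ord0).
Qed.

Lemma word_index_codom (i : {ffun 'I_d -> 'I_n.+1}) : word_index (codom i) = i.
Proof.
apply/ffunP=> j; rewrite ffunE (nth_map j) ?size_enum_ord //.
by rewrite nth_ord_enum.
Qed.

Lemma word_coord_sum r (c : 'I_r -> k) (T : 'I_r -> tensor k n d) s :
  word_coord (\sum_q c q *: T q) s = \sum_q c q * word_coord (T q) s.
Proof.
by rewrite /word_coord sum_ffunE; apply: eq_bigr => q _; rewrite ffunE.
Qed.

Lemma word_coord_pure (v : 'I_d -> 'rV[k]_n.+1) s :
  word_coord (pure_tensor v) s = \prod_(j < d) v j 0 (nth ord0 s j).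
Proof. by rewrite /word_coord ffunE; apply: eq_bigr => j _; rewrite ffunE. Qed.

Lemma word_coord_power (v : 'rV[k]_n.+1) s :
  size s = d -> word_coord (power_tensor d v) s = \prod_(x <- s) v 0 x.
Proof.
by move=> sd; rewrite word_coord_pure (big_nth ord0) sd big_mkord.
Qed.

End WordCoordinates.

(** * Catalecticant matrices of tensors of odd order *)

Section Catalecticants.
Variables (k : closedFieldType) (n m : nat).
Local Notation d := (m + m).+1.
Local Notation h := (nmono n m).+1.
Implicit Types (T : tensor k n d) (l : 'I_n.+1) (v : 'rV[k]_n.+1).

Definition cat_word l (a b : 'I_h) : seq 'I_n.+1 := l :: mono a ++ mono b.

Lemma size_cat_word l a b : size (cat_word l a b) = d.
Proof. by rewrite /= size_cat !size_mono. Qed.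

(** For symmetric T this is, up to normalization, the middle catalecticant of the l-th partial
    derivative of the associated form. *)
Definition catalecticant T l : 'M[k]_h :=
  \matrix_(a, b) word_coord T (cat_word l a b).

Lemma catalecticant0 l : catalecticant 0 l = 0.
Proof. by apply/matrixP=> a b; rewrite !mxE /word_coord ffunE. Qed.

Lemma catalecticant_sym T l :
  symmetric_tensor T -> (catalecticant T l)^T = catalecticant T l.
Proof.
move=> symT; apply/matrixP=> a b; rewrite !mxE.
by apply: word_coord_perm; rewrite ?size_cat_word // perm_cons perm_catC.
Qed.

(** On a pure tensor, an entry is a function of [a] times a function of [b]; hence r pure tensors
    give a matrix factoring through k^r. *)
Lemma rank_catalecticant_le r (c : 'I_r -> k) (v : 'I_r -> 'I_d -> 'rV[k]_n.+1) l :
  (\rank (catalecticant (\sum_q c q *: pure_tensor (v q)) l) <= r)%N.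
Proof.
pose A : 'M[k]_(h, r) := \matrix_(a, q)
  (c q * (v q ord0 0 l *
          \prod_(j < m) v q (lift ord0 (lshift m j)) 0 (nth ord0 (mono a) j))).
pose B : 'M[k]_(r, h) := \matrix_(q, b)
  \prod_(j < m) v q (lift ord0 (rshift m j)) 0 (nth ord0 (mono b) j).
suff -> : catalecticant (\sum_q c q *: pure_tensor (v q)) l = A *m B.
  exact: leq_trans (mxrankM_maxl _ _) (rank_leq_col _).
apply/matrixP=> a b; rewrite !mxE word_coord_sum; apply: eq_bigr => q _.
rewrite !mxE -mulrA; congr (_ * _); rewrite word_coord_pure big_ord_recl /=.
rewrite -mulrA big_split_ord /=; congr (_ * (_ * _)); apply: eq_bigr => j _.
  by rewrite /= nth_cat size_mono ltn_ord.
by rewrite /= nth_cat size_mono ltnNge leq_addr add0n addKn.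
Qed.

(** Multivariate Vandermonde matrix of the points [v]. *)
Definition mono_mx r (v : 'I_r -> 'rV[k]_n.+1) : 'M[k]_(r, h) :=
  \matrix_(q, a) \prod_(x <- mono a) v q 0 x.

Lemma catalecticant_powers r (c : 'I_r -> k) (v : 'I_r -> 'rV[k]_n.+1) l :
  catalecticant (\sum_q c q *: power_tensor d (v q)) l =
  (mono_mx v)^T *m diag_mx (\row_q c q) *m diag_mx (\row_q v q 0 l) *m mono_mx v.
Proof.
apply/matrixP=> a b; rewrite -mulmxA mul_mx_diag mul_diag_mx !mxE word_coord_sum.
apply: eq_bigr => q _; rewrite !mxE word_coord_power ?size_cat_word //.
by rewrite big_cons big_cat /=; ring.
Qed.

(** Diagonalization gives T at l :: t ++ u as the sum over s of b_s c_l(s) p_s(t) p_s(u), with p_s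
    the row s of P read on words. Symmetry of T makes p_s(t) proportional to the product of the
    c_x(s) over the letters x of t, so term s is a multiple of the d-th power of the vector
    (c_l(s))_l. *)
Lemma symmetric_tensor_decomposition T l1 :
  let A := catalecticant T in let Y := \adj (A ord0) *m A l1 in
  symmetric_tensor T -> A ord0 \in unitmx ->
  horner_mx Y (char_poly Y)^`() \in unitmx ->
  (forall l, A l1 *m invmx (A ord0) *m A l = A l *m invmx (A ord0) *m A l1) ->
  exists (c : 'I_h -> k) (v : 'I_h -> 'rV[k]_n.+1),
    [/\ forall s, v s 0 ord0 = 1, injective (fun s => v s 0 l1)
      & T = \sum_s c s *: power_tensor d (v s)].
Proof.
move=> A Y symT uA uY commA.
have symA l : (A l)^T = A l by apply: catalecticant_sym.
have [P [b [c [uP b0 c0 cI AE]]]] :=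
  symmetric_pencil_diagonalization uA uY symA commA.
pose p s t := P s (mono_idx m t).
have p_perm s t u : perm_eq t u -> p s t = p s u.
  by move=> tu; rewrite /p (mono_idx_perm _ tu).
have TE l t u : size t = m -> size u = m ->
    word_coord T (l :: t ++ u) = \sum_s b 0 s * c l 0 s * (p s t * p s u).
  move=> tm um; have := AE l => /matrixP/(_ (mono_idx m t) (mono_idx m u)).
  rewrite mxE -mulmxA mul_mx_diag mul_diag_mx !mxE => AtuE.
  have -> : word_coord T (l :: t ++ u)
          = word_coord T (cat_word l (mono_idx m t) (mono_idx m u)).
    apply: word_coord_perm; rewrite ?size_cat_word // perm_cons.
    by apply: perm_cat; apply: perm_mono_idx.
  by rewrite AtuE; apply: eq_bigr => s _; rewrite !mxE /p; ring.
(* Exchanging l and j in a coordinate of T gives a linear relation between the rows of P; they are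
   independent, so it holds for each s separately. *)
have swap s l j t : size (j :: t) = m ->
    c l 0 s * p s (j :: t) = c j 0 s * p s (l :: t).
  move=> jtm; pose g : 'cV[k]_h :=
    \col_s (b 0 s * (c l 0 s * p s (j :: t) - c j 0 s * p s (l :: t))).
  suff /matrixP/(_ s 0) : g = 0.
    rewrite !mxE => /eqP; rewrite mulf_eq0 (negPf (b0 s)) subr_eq0 /=.
    by move/eqP.
  have uPT : P^T \in unitmx by rewrite unitmx_tr.
  apply: (can_inj (mulKmx uPT)); rewrite mulmx0.
  apply/matrixP=> a i; rewrite !mxE.
  have : word_coord T (l :: (j :: t) ++ mono a)
       = word_coord T (j :: (l :: t) ++ mono a).
    apply: word_coord_perm; rewrite //= ?size_cat ?size_mono -?jtm //.
    by rewrite (perm_catCA [:: l] [:: j]).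
  rewrite !TE ?size_mono // => /eqP; rewrite -subr_eq0 -sumrB => /eqP E0.
  by rewrite -[RHS]E0; apply: eq_bigr => q _; rewrite !mxE /p mono_idxK; ring.
(* Exchanging the slice index with a letter of the word moves that letter out
   of [p s] as a factor [c]. *)
have factor s t : forall u, size (t ++ u) = m ->
    p s (t ++ u) = \prod_(x <- t) c x 0 s * p s (nseq (size t) ord0 ++ u).
  elim: t => [|x t IH] u xtum; first by rewrite big_nil mul1r.
  have -> : p s ((x :: t) ++ u) = c x 0 s * p s (ord0 :: t ++ u).
    by rewrite -swap // c0 mul1r.
  rewrite big_cons -mulrA; congr (_ * _).
  have catS y r : perm_eq (y :: r ++ u) (r ++ y :: u).
    by rewrite -cat_rcons -cat_cons perm_cat2r perm_sym perm_rcons.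
  rewrite /= (p_perm s _ _ (catS ord0 t)) IH; last by rewrite -xtum !size_cat addnS.
  by congr (_ * _); apply: p_perm; rewrite perm_sym.
have pE s t : size t = m ->
    p s t = \prod_(x <- t) c x 0 s * p s (nseq m ord0).
  by move=> tm; have := factor s t [::]; rewrite !cats0 tm; apply.
(* Each half of the word contributes one constant [p s (nseq m ord0)], hence the square. *)
exists (fun s => b 0 s * p s (nseq m ord0) ^+ 2), (fun s => \row_l c l 0 s).
split=> [s | s t | ]; first by rewrite mxE.
  by rewrite !mxE => /cI.
apply/ffunP=> i; rewrite -(word_index_codom i) -/(word_coord T _).
rewrite -/(word_coord (\sum_s _) _) word_coord_sum.
have : size (codom i) = d by rewrite size_codom card_ord.
case: (codom i) => [//|l w] [wm].
have tm : size (take m w) = m by rewrite size_takel // wm leq_addr.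
have um : size (drop m w) = m by rewrite size_drop wm addKn.
rewrite -(cat_take_drop m w) TE //; apply: eq_bigr => s _.
rewrite word_coord_power; last by rewrite /= size_cat tm um.
have vE r : \prod_(x <- r) (\row_j c j 0 s) 0 x = \prod_(x <- r) c x 0 s.
  by apply: eq_bigr => x _; rewrite mxE.
rewrite big_cons big_cat /= !vE (pE _ _ tm) (pE _ _ um) mxE.
move: (\prod_(x <- take m w) _) (\prod_(x <- drop m w) _) => Pt Pu.
by move: (p s _) => p0; ring.
Qed.

(** Write A_l = M^T E_l M with E_l diagonal. With exactly h points M is square, so invertibility of
    A_0 passes to M and E_0, and A_i A_0^-1 A_j = M^T E_0^-1 E_i E_j M is symmetric in i and j. *)
Lemma catalecticant_powers_comm (c : 'I_h -> k) (v : 'I_h -> 'rV[k]_n.+1) l1 l :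
  let A := catalecticant (\sum_q c q *: power_tensor d (v q)) in
  A ord0 \in unitmx ->
  A l1 *m invmx (A ord0) *m A l = A l *m invmx (A ord0) *m A l1.
Proof.
move=> A; pose M := mono_mx v; pose e j : 'rV_h := \row_q (c q * v q 0 j).
have AE j : A j = M^T *m diag_mx (e j) *m M.
  rewrite /A catalecticant_powers -[in LHS](mulmxA _^T) mulmx_diag.
  by congr (_ *m diag_mx _ *m _); apply/rowP=> q; rewrite !mxE.
rewrite {1}AE !unitmx_mul => /andP[/andP[uMT ue] uM].
have A0E : invmx (A ord0) = invmx M *m invmx (diag_mx (e ord0)) *m invmx M^T.
  have uA : A ord0 \in unitmx by rewrite AE !unitmx_mul uMT ue uM.
  apply: (can_inj (mulKmx uA)); rewrite mulmxV // AE !mulmxA.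
  by rewrite mulmxK // mulmxK // mulmxV.
have comm0 j : diag_mx (e j) *m invmx (diag_mx (e ord0))
             = invmx (diag_mx (e ord0)) *m diag_mx (e j).
  apply: (can_inj (mulKmx ue)); rewrite mulKVmx //.
  by rewrite mulmxA (diag_mxC (e ord0)) mulmxK.
have AAE i j : A i *m invmx (A ord0) *m A j
    = M^T *m (invmx (diag_mx (e ord0)) *m (diag_mx (e i) *m diag_mx (e j))) *m M.
  rewrite A0E !AE !mulmxA mulmxK // (mulmxKV uMT).
  by rewrite -!(mulmxA M^T) comm0 !mulmxA.
by rewrite !AAE (diag_mxC (e l1)).
Qed.

End Catalecticants.

(** * Polynomial conditions on the secant variety and the two rank bounds *)

Section GenericCatalecticant.
Variables (k : closedFieldType) (n m : nat).
Local Notation d := (m + m).+1.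
Local Notation h := (nmono n m).+1.
Local Notation Tn := (tensor k n d).
Local Notation R := {mpoly k[\dim {:Tn}]}.
Local Notation ev T := (meval (fun i => coord (vbasis {:Tn}) i T)).
Implicit Types (T : Tn) (l : 'I_n.+1).

(** Since [peval] works in the basis [vbasis], an entry of a tensor is a linear form and not a
    variable. *)
Definition coord_poly (i : {ffun 'I_d -> 'I_n.+1}) : R :=
  \sum_(j < \dim {:Tn}) (vbasis {:Tn})`_j i *: 'X_j.

Lemma meval_coord_poly i T : ev T (coord_poly i) = T i.
Proof.
rewrite raddf_sum /= {2}(coord_vbasis (memvf T)) sum_ffunE.
by apply: eq_bigr => j _; rewrite mevalZ mevalXU ffunE mulrC.
Qed.

Definition generic_catalecticant l : 'M[R]_h :=
  \matrix_(a, b) coord_poly (word_index d (cat_word l a b)).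
Local Notation G := generic_catalecticant.

Lemma map_generic_catalecticant T l :
  map_mx (ev T) (G l) = catalecticant T l.
Proof. by apply/matrixP=> a b; rewrite !mxE meval_coord_poly. Qed.

Lemma meval_det_catalecticant T :
  ev T (\det (G ord0)) = \det (catalecticant T ord0).
Proof. by rewrite -det_map_mx map_generic_catalecticant. Qed.

(* The second factor vanishes exactly when the characteristic polynomial of
   \adj (A 0) *m A l1 has a multiple root. *)
Definition discriminant_poly l1 : R :=
  let Y := \adj (G ord0) *m G l1 in
  \det (G ord0) * \det (horner_mx Y (char_poly Y)^`()).

Lemma meval_discriminant_poly T l1 :
  let A := catalecticant T in let Y := \adj (A ord0) *m A l1 in
  ev T (discriminant_poly l1) =
  \det (A ord0) * \det (horner_mx Y (char_poly Y)^`()).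
Proof.
rewrite rmorphM /= meval_det_catalecticant -det_map_mx map_horner_mx.
by rewrite -deriv_map map_char_poly map_mxM map_mx_adj !map_generic_catalecticant.
Qed.

(* The factor \det (G ord0) makes this vanish on all sums of h powers, also
   where A 0 is singular and the inverse is not available. *)
Definition commutator_poly l1 l a b : R :=
  \det (G ord0) * (G l1 *m \adj (G ord0) *m G l
                   - G l *m \adj (G ord0) *m G l1) a b.

Lemma meval_commutator_poly T l1 l a b : let A := catalecticant T in
  ev T (commutator_poly l1 l a b) =
  \det (A ord0) * (A l1 *m \adj (A ord0) *m A l
                   - A l *m \adj (A ord0) *m A l1) a b.
Proof.
rewrite rmorphM /= meval_det_catalecticant; congr (_ * _).
have <- : map_mx (ev T) (G l1 *m \adj (G ord0) *m G l
                         - G l *m \adj (G ord0) *m G l1)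
  = catalecticant T l1 *m \adj (catalecticant T ord0) *m catalecticant T l
    - catalecticant T l *m \adj (catalecticant T ord0) *m catalecticant T l1.
  by rewrite map_mxB !map_mxM map_mx_adj !map_generic_catalecticant.
by rewrite [RHS]mxE.
Qed.

Lemma secant_catalecticant_comm (x : proj Tn) T l1 l :
  let A := catalecticant T in
  secant veronese h x -> T \in line x -> A ord0 \in unitmx ->
  A l1 *m invmx (A ord0) *m A l = A l *m invmx (A ord0) *m A l1.
Proof.
move=> A Sx Tx uA.
have : forall p, (exists a b, p = commutator_poly l1 l a b) -> zero_at p x.
  apply: Sx (zclosed_zeros _) _ => y [z [Vz _ /subvP yz]] _ [a [b ->]] w.
  have /fin_all_exists[v vP] q : exists v, line (z q) = <[power_tensor d v]>%VS.
    by have [v [_ vE]] := Vz q; exists v.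
  move=> /yz /(memv_pspanP _ vP)[c ->]; rewrite /peval meval_commutator_poly.
  set B := catalecticant _; have [-> | B0] := eqVneq (\det (B ord0)) 0.
    by rewrite mul0r.
  have uB : B ord0 \in unitmx by rewrite unitmxE unitfE.
  rewrite adjmx_unit // -!scalemxAr -!scalemxAl -scalerBr.
  by rewrite catalecticant_powers_comm // subrr scaler0 mxE mulr0.
move=> x0; apply/eqP; rewrite -subr_eq0; apply/eqP/matrixP=> a b.
have /eqP := x0 _ (ex_intro _ a (ex_intro _ b erefl)) T Tx.
rewrite /peval meval_commutator_poly mulf_eq0 -/A.
have A0 : \det (A ord0) != 0 by rewrite -unitfE -unitmxE.
(* Two determinants are cancelled: the factor put into [commutator_poly] and the one coming from the
   adjugate. *)
rewrite (negPf A0) adjmx_unit // -!scalemxAr -!scalemxAl -scalerBr [_ a b]mxE.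
by rewrite mulf_eq0 (negPf A0) => /eqP ->; rewrite mxE.
Qed.

Lemma in_span_of_segre_ge r (x : proj Tn) T :
  in_span_of segre r x -> T \in line x -> catalecticant T ord0 \in unitmx ->
  (h <= r)%N.
Proof.
case=> y [_ Sy /subvP yx] /yx Ty uA.
have /fin_all_exists[v vP] q : exists v, line (y q) = <[pure_tensor v]>%VS.
  by have [v [_ vE]] := Sy q; exists v.
have /(memv_pspanP _ vP)[c TE] := Ty.
by rewrite -(mxrank_unit uA) TE rank_catalecticant_le.
Qed.

Lemma in_span_of_veronese (x : proj Tn) T l1 :
  let A := catalecticant T in let Y := \adj (A ord0) *m A l1 in
  secant veronese h x -> T \in line x -> T != 0 -> A ord0 \in unitmx ->
  horner_mx Y (char_poly Y)^`() \in unitmx -> in_span_of veronese h x.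
Proof.
move=> A Y Sx Tx T0 uA uY.
have [c [v [v0 vI TE]]] := symmetric_tensor_decomposition
  (secant_veronese_symmetric Sx Tx) uA uY
  (fun l => secant_catalecticant_comm l1 l Sx Tx uA).
have vn0 s : v s != 0.
  by apply: contra_eq_neq (v0 s) => ->; rewrite mxE eq_sym oner_eq0.
have pn0 s : power_tensor d (v s) != 0 by apply: pure_tensor_neq0.
exists (fun s => proj_of (pn0 s)); split=> [s t | s | ].
- move/(congr1 (@line _ _)) => /= vst; apply: vI.
  have /vlineP[a vs] : power_tensor d (v s) \in <[power_tensor d (v t)]>%VS.
    by rewrite -vst memv_line.
  (* Because the vectors have first coordinate 1, the power of [v s] has coordinate [v s 0 l] at the
     word l 0 ... 0. Equal points thus force equal coordinates l1, against [vI] for distinct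
     indices. *)
  have coordE l : v s 0 l = a * v t 0 l.
    have := congr1 (fun T => word_coord T (l :: nseq (m + m) ord0)) vs.
    have -> : word_coord (a *: power_tensor d (v t)) (l :: nseq (m + m) ord0) =
       a * word_coord (power_tensor d (v t)) (l :: nseq (m + m) ord0).
      by rewrite /word_coord ffunE.
    rewrite !word_coord_power /= ?size_nseq // !big_cons.
    have n1 q : \prod_(i <- nseq (m + m) ord0) v q 0 i = 1.
      by rewrite big1_seq // => i /andP[_ /nseqP[-> _]].
    by rewrite !n1 !mulr1.
  have := coordE ord0; rewrite !v0 mulr1 => a1.
  by rewrite /= coordE -a1 mul1r.
- by exists (v s).
rewrite (proj_lineE Tx T0) -memvE.
apply/(memv_pspanP T (u := fun s => power_tensor d (v s))).
  by [].
by exists c.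
Qed.

End GenericCatalecticant.

(** * Uniqueness of digits, and integers in characteristic zero *)

Section PowersOfTwo.

Lemma digits_inj B n (a b : 'I_n -> nat) :
  (forall i, a i < B)%N -> (forall i, b i < B)%N ->
  (\sum_(i < n) a i * B ^ i = \sum_(i < n) b i * B ^ i)%N -> a =1 b.
Proof.
elim: n a b => [|n IH] a b aB bB; first by move=> _ [].
have shift (f : 'I_n.+1 -> nat) :
    (\sum_(i < n.+1) f i * B ^ i =
     (\sum_(i < n) f (lift ord0 i) * B ^ i) * B + f ord0)%N.
  rewrite big_ord_recl expn0 muln1 addnC big_distrl /=; congr (_ + _)%N.
  by apply: eq_bigr => i _; rewrite -mulnA -expnSr.
rewrite !shift => E; have B0 : (0 < B)%N by apply: leq_trans (aB ord0).
have ab0 : a ord0 = b ord0.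
  by have := congr1 (modn^~ B) E; rewrite !modnMDl !modn_small.
have abS : (\sum_(i < n) a (lift ord0 i) * B ^ i
            = \sum_(i < n) b (lift ord0 i) * B ^ i)%N.
  by move/eqP: E; rewrite ab0 eqn_add2r eqn_pmul2r // => /eqP.
move=> i; case: (unliftP ord0 i) => [j|] -> //.
exact: (IH (fun i => a (lift ord0 i)) (fun i => b (lift ord0 i))).
Qed.

(** The multiplicities of the letters are the base B digits of the sum, the length bound keeping
    them below B. *)
Lemma sum_expn_perm B n (s t : seq 'I_n) : (size s < B)%N -> (size t < B)%N ->
  (\sum_(x <- s) B ^ x = \sum_(x <- t) B ^ x)%N -> perm_eq s t.
Proof.
have countE (u : seq 'I_n) :
    (\sum_(x <- u) B ^ x = \sum_(i < n) count_mem i u * B ^ i)%N.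
  elim: u => [|x u IH]; first by rewrite big_nil big1.
  rewrite big_cons IH [RHS](eq_bigr (fun i : 'I_n =>
    (x == i) * B ^ i + count_mem i u * B ^ i)%N).
    rewrite big_split /=; congr (_ + _)%N; rewrite (bigD1 x) //= eqxx mul1n.
    by rewrite big1 ?addn0 // => i; rewrite eq_sym => /negPf ->.
  by move=> i _; rewrite -mulnDl.
move=> sB tB; rewrite !countE => /digits_inj E.
apply/allP=> i _; apply/eqP/E => j; exact: leq_ltn_trans (count_size _ _) _.
Qed.

Lemma natr_inj_pchar0 (k : idomainType) : [pchar k] =i pred0 ->
  injective (fun a => a%:R : k).
Proof.
move=> /pcharf0P k0 a b; wlog ab : a b / (a <= b)%N => [W | /eqP].
  by case: (leqP a b) => [/W//|/ltnW /W H /esym/H].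
rewrite eq_sym -subr_eq0 -natrB // k0 subn_eq0 => ba.
by apply/eqP; rewrite eqn_leq ab.
Qed.

End PowersOfTwo.

(** * An explicit nondegenerate sum of powers, and the result for odd degree *)

Section Example.
Variables (k : closedFieldType) (n m : nat).
Hypothesis char0 : [pchar k] =i pred0.
Hypothesis n_gt0 : (0 < n)%N.
Local Notation d := (m + m).+1.
Local Notation h := (nmono n m).+1.
(** The base exceeds m, so multiplicities in words of length m are digits, and it exceeds 1 even for
    m = 0, so B^n - 1 is positive. *)
Local Notation B := m.+2.

Lemma exp2_inj : injective (fun a => 2%:R ^+ a : k).
Proof.
move=> a b; rewrite -!natrX => /(natr_inj_pchar0 char0)/eqP.
by rewrite eqn_exp2l // => /eqP.
Qed.

(* With these exponents distinct monomials of degree m take values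
   (2 ^ e) ^ s at the s-th node, with distinct e: Vandermonde applies. *)
Definition node (s : 'I_h) : 'rV[k]_n.+1 :=
  \row_i 2%:R ^+ (s * (B ^ i).-1).

Lemma node0 s : node s 0 ord0 = 1.
Proof. by rewrite mxE muln0. Qed.

Lemma node_max_inj : injective (fun s => node s 0 ord_max).
Proof.
move=> s t; rewrite !mxE => /exp2_inj/eqP; rewrite eqn_pmul2r.
  by move/eqP/ord_inj.
by rewrite -subn1 subn_gt0 -(expn0 B) ltn_exp2l.
Qed.

Lemma mono_mx_node_unit : mono_mx m node \in unitmx.
Proof.
pose e (a : 'I_h) := (\sum_(x <- mono a) (B ^ x).-1)%N.
have -> : mono_mx m node = Vandermonde h (\row_a 2%:R ^+ e a).
  apply/matrixP=> s a; rewrite !mxE -exprM mulnC /e big_distrr /= -prodrXr.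
  by apply: eq_bigr => x _; rewrite mxE.
have e_inj : injective e.
  move=> a b eab; apply: perm_mono_inj; apply: (@sum_expn_perm B).
  - by rewrite size_mono.
  - by rewrite size_mono.
  (* Each of the m letters lowers the exponent by 1, a shift common to all monomials. *)
  have eE c : (\sum_(x <- mono c) B ^ x = e c + m)%N.
    rewrite -[X in (_ + X)%N](size_mono c) -sum1_size -big_split /=.
    by apply: eq_bigr => x _; rewrite addn1 prednK // expn_gt0.
  by rewrite !eE eab.
rewrite unitmxE unitfE det_Vandermonde.
apply/prodf_neq0 => i _; apply/prodf_neq0 => j ij.
rewrite !mxE subr_eq0; apply: contraTneq ij => /exp2_inj/e_inj ->.
by rewrite ltnn.
Qed.

(** The explicit coefficients 1 match the shape of [catalecticant_powers]. *)
Definition node_sum : tensor k n d := \sum_s 1 *: power_tensor d (node s).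

Lemma node_power_neq0 s : power_tensor d (node s) != 0.
Proof.
apply: pure_tensor_neq0 => _.
by apply: contra_eq_neq (node0 s) => ->; rewrite mxE eq_sym oner_eq0.
Qed.

(** A linear relation c between the powers gives M^T diag(c) M = 0 with M invertible, hence c =
    0. *)
Lemma dim_node_span :
  \dim (pspan (fun s => proj_of (node_power_neq0 s))) = h.
Proof.
pose X := [tuple power_tensor d (node s) | s < h].
suff /eqP : free X.
  rewrite size_tuple => dimX; apply: etrans dimX.
  rewrite span_def big_tuple; congr (\dim _).
  by apply: eq_bigr => s _; rewrite tnth_mktuple.
apply/freeP=> c c0 s; pose M := mono_mx m node.
have uM : M \in unitmx := mono_mx_node_unit.
have cE : \sum_q c q *: power_tensor d (node q) = 0.
  by rewrite -[RHS]c0; apply: eq_bigr => q _; rewrite -tnth_nth tnth_mktuple.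
have : catalecticant (\sum_q c q *: power_tensor d (node q)) ord0 = 0.
  by rewrite cE catalecticant0.
rewrite catalecticant_powers -/M => /(canRL (mulmxK uM)); rewrite mul0mx.
rewrite -mulmxA; have uMT : M^T \in unitmx by rewrite unitmx_tr.
move/(canRL (mulKmx uMT)); rewrite mulmx0 mulmx_diag => /matrixP/(_ s s).
by rewrite !mxE eqxx muln0 mulr1.
Qed.

Lemma catalecticant_node_sum l : catalecticant node_sum l =
  (mono_mx m node)^T *m diag_mx (\row_s node s 0 l) *m mono_mx m node.
Proof.
rewrite catalecticant_powers -[in LHS](mulmxA _^T) mulmx_diag.
by congr (_ *m diag_mx _ *m _); apply/rowP=> s; rewrite !mxE mul1r.
Qed.

(** The nodes have first coordinate 1, so A_0 = M^T M, and A_0^-1 A_n is conjugate by M to the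
    diagonal matrix of the last coordinates, which are distinct. *)
Lemma node_sum_nondegenerate :
  let A := catalecticant node_sum in let Y := \adj (A ord0) *m A ord_max in
  A ord0 \in unitmx /\ horner_mx Y (char_poly Y)^`() \in unitmx.
Proof.
set M := mono_mx m node; have uM : M \in unitmx := mono_mx_node_unit.
have uMT : M^T \in unitmx by rewrite unitmx_tr.
move=> A; have A0E : A ord0 = M^T *m M.
  rewrite /A catalecticant_node_sum -/M.
  have -> : \row_s node s 0 ord0 = const_mx 1.
    by apply/rowP=> s; rewrite mxE node0 mxE.
  by rewrite diag_const_mx mulmx1.
have uA : A ord0 \in unitmx by rewrite A0E unitmx_mul uMT uM.
split=> //; apply/unitmx_deriv_char_polyP.
have det0 : \det (A ord0) != 0 by rewrite -unitfE -unitmxE.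
exists M, (\det (A ord0) *: \row_s node s 0 ord_max); split=> //.
  by move=> s t; rewrite !mxE => /(mulfI det0) E; apply: node_max_inj; rewrite /= !mxE.
rewrite adjmx_unit // [diag_mx _]linearZ -!scalemxAl -scalemxAr; congr (_ *: _).
apply: (can_inj (mulKmx uMT)); rewrite (mulmxA M^T) -A0E.
by rewrite mulKVmx // /A catalecticant_node_sum mulmxA.
Qed.

Lemma node_sum_neq0 : node_sum != 0.
Proof.
have [uA _] := node_sum_nondegenerate; apply: contraTneq uA => ->.
by rewrite catalecticant0 unitmxE det0 unitr0.
Qed.

Lemma secant_node_sum : secant veronese h (proj_of node_sum_neq0).
Proof.
move=> Z _; apply; exists (fun s => proj_of (node_power_neq0 s)); split.
- move=> s; exists (node s); split=> //.
  by apply: contra_eq_neq (node0 s) => ->; rewrite mxE eq_sym oner_eq0.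
- exact: dim_node_span.
rewrite -memvE; apply/(memv_pspanP _ (u := fun s => power_tensor d (node s))).
  by [].
by exists (fun=> 1).
Qed.

(** Off the discriminant the ranks are squeezed: h <= Segre rank <= Veronese rank <= h. *)
Lemma comon_general_odd :
  exists U : proj (tensor k n d) -> Prop,
    [/\ zopen_in (secant veronese h) U, exists F, U F
      & forall F, U F ->
          exists r, has_rank veronese F r /\ has_rank segre F r].
Proof.
pose D := discriminant_poly k m (ord_max : 'I_n.+1).
exists (fun x => secant veronese h x /\ ~ zero_at D x); split.
- by exists (zero_at D) => //; apply: zclosed_zero_at.
- exists (proj_of node_sum_neq0); split; first exact: secant_node_sum.
  move/(_ _ (memv_line _))/eqP; rewrite /peval meval_discriminant_poly.
  have [uA uY] := node_sum_nondegenerate.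
  rewrite !unitmxE !unitfE in uA uY.
  by rewrite mulf_eq0 (negPf uA) (negPf uY).
move=> x [Sx /zero_atPn[T Tx]]; rewrite /peval meval_discriminant_poly.
rewrite mulf_eq0 negb_or -!unitfE -!unitmxE => /andP[uA uY].
have T0 : T != 0.
  by apply: contraTneq uA => ->; rewrite catalecticant0 unitmxE det0 unitr0.
have Vx := in_span_of_veronese Sx Tx T0 uA uY.
have Sge r : in_span_of segre r x -> (h <= r)%N.
  by move=> Sr; apply: in_span_of_segre_ge Sr Tx uA.
have VS r : in_span_of veronese r x -> in_span_of segre r x.
  by case=> y [yI Vy yx]; exists y; split=> // i; apply: veronese_segre.
exists h; split; split=> //; last exact: VS.
by move=> r /VS/Sge.
Qed.

End Example.

Theorem theorem4p8 (k : closedFieldType) (char0 : [pchar k] =i pred0)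
    (n d : nat) (hn : (2 <= n)%N)
    (hcase : (d = 3%N /\ (2 <= n <= 30)%N) \/
             (d = 5%N /\ (3 <= n <= 8)%N) \/
             (d = 7%N /\ n = 4%N)) :
  let h := 'C(n + d./2, n) in
  exists U : proj (tensor k n d) -> Prop,
    [/\ zopen_in (secant (@veronese k n d) h) U,
        exists F, U F
      & forall F, U F ->
          exists r : nat,
            has_rank (@veronese k n d) F r /\ has_rank (@segre k n d) F r].
Proof.
have n_gt0 : (0 < n)%N by apply: leq_trans hn.
move=> h; rewrite /h; case: hcase => [[dE _]|[[dE _]|[dE _]]]; subst d.
(* The cases are d = 2m + 1 with m = 1, 2, 3, where [d./2] computes to m. *)
- by rewrite -(nmonoE n 1); apply: (comon_general_odd 1).
- by rewrite -(nmonoE n 2); apply: (comon_general_odd 2).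
by rewrite -(nmonoE n 3); apply: (comon_general_odd 3).
Qed.
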